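(* Let $P=(p_1,p_2,\dots)$ and $Q=(q_1,q_2,\dots)$ be properly arranged with $P>Q$, and let $\sum_{(P,Q)}$ be the $2$-solenoid of the sequence of matrices $\big(\mathrm{diag}(p_j,q_j)\big)_{j\ge1}$. Whenever two irrational linear flows $\Phi^{\mathbf\omega}$ and $\Phi^{\mathbf\omega'}$ on $\sum_{(P,Q)}$ are equivalent, there is a matrix $A=\begin{pmatrix}a&0\\c&d\end{pmatrix}$, where $c$ and $\frac{c}{ad}$ are proper $P\to Q$ multipliers, $a$ is a $(P)$ iso-multiplier and $d$ is a $(Q)$ iso-multiplier, such that $A$ represents an automorphism $A_{(P,Q)}$ of $\sum_{(P,Q)}$ and $\alpha\times A_{(P,Q)}$ is an equivalence from $\Phi^{\mathbf\omega}$ to $\Phi^{\mathbf\omega'}$ for some increasing continuous homomorphism $\alpha:\mathbb R\to\mathbb R$.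
   Context: All homomorphisms of topological groups are continuous. $S^1=\mathbb R/\mathbb Z$, $\mathbf T^n=\prod_{i=1}^nS^1$, $p^n:\mathbb R^n\to\mathbf T^n$ is coordinatewise reduction mod $1$. $n$-solenoid: for a sequence $\overline M=(M_1,M_2,\dots)$ of $n\times n$ integer matrices with non-zero determinants, $\sum_{\overline M}=\{(\mathbf x^j)_{j\ge1}\in\prod_{j=1}^\infty\mathbf T^n:\mathbf x^j=f_j^{j+1}(\mathbf x^{j+1})\ \forall j\}$, where $f_j^{j+1}\circ p^n=p^n\circ M_j$; it is a topological group. $\pi_{\overline M}:\mathbb R^n\to\sum_{\overline M}$ is $\mathbf t\mapsto(p^n(\mathbf t),p^n(M_1^{-1}\mathbf t),\dots,p^n(M_j^{-1}\cdots M_1^{-1}\mathbf t),\dots)$. A matrix $A$ represents an automorphism $h$ of $\sum_{\overline M}$ if $h\circ\pi_{\overline M}=\pi_{\overline M}\circ A$ (such $h$ is unique; here it is denoted $A_{(P,Q)}$). For a sequence $P=(p_1,p_2,\dots)$ of non-zero integers, $\sum_P$, $\pi_P$ denote the case $n=1$, $M_j=(p_j)$; $\mathbf C_P=\pi_P(\mathbb R)$ is the path component of the identity of $\sum_P$, with the subspace topology. Linear flows: for $\mathbf\omega=(\omega_1,\omega_2)\neq\mathbf 0$, $\Phi^{\mathbf\omega}(t,x)=\pi_{\overline M}(t\mathbf\omega)+x$; it is irrational if $k_1\omega_1+k_2\omega_2=0$ with integers $k_1,k_2$ implies $k_1=k_2=0$. Equivalence: flows $\phi$ on $X$ and $\psi$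 on $Y$ are equivalent if there are an increasing homomorphism $\alpha:\mathbb R\to\mathbb R$ and a homeomorphism $h:X\to Y$ with $h(\phi(t,x))=\psi(\alpha(t),h(x))$ for all $t,x$; then $\alpha\times h$ is called an equivalence from $\phi$ to $\psi$. Multipliers: for $r\in\mathbb R$ define $r^{P\to Q}:\mathbf C_P\to\mathbf C_Q$ by $r^{P\to Q}(\pi_P(s))=\pi_Q(rs)$ for $s\in\mathbb R$ if $P$ is not eventually $1$; if $P$ is eventually $1$ and $p$ is the product of all its terms, then $\pi_P:[0,p)\to\mathbf C_P$ is a bijection and $r^{P\to Q}(\pi_P(s))=\pi_Q(rs)$ for $s\in[0,p)$. $r$ is a proper $P\to Q$ multiplier if $r^{P\to Q}$ is a continuous homomorphism; $r$ is a $(P)$ iso-multiplier if $r$ and $\frac1r$ are proper $P\to P$ multipliers. Order and proper arrangement. The derived sequence $P'$ of a sequence $P$ of non-zero integers is the sequence of primes and $1$'s obtained by replacing successively each $|p_i|$ by its prime factors (with multiplicity) in order of magnitude, each term with $|p_i|=1$ being replaced by $1$. For a prime $q$, $card_q(P')$ is the number (possibly $\infty$) of occurrences of $q$ in $P'$. $P\le Q$ means: finitely many terms may be deleted from $P'$ so that each prime occurring in the resulting sequence occurs in $Q'$ with the same or greater cardinality. $P>Q$ means $Q\le P$ but not $P\le Q$. Let $f_0(k,i)=\frac{(k+i-2)(k+i-1)}2+i$, a bijection $\mathbb N\times\mathbb N\to\mathbb N$, $\mathbb N=\{1,2,\dots\}$. The proper arrangement of $P_1,\dots,P_n$ is the list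 $Q_1=(q^1_1,q^1_2,\dots),\dots,Q_n=(q^n_1,q^n_2,\dots)$ defined as follows, separately for each $k\in\mathbb N$, where $\ell_k$ is the $k$-th prime. Start with $J=\{1,\dots,n\}$. Let $\mu=\max\{card_{\ell_k}(P_j'):j\in J\}$ and $m=\min\{j\in J:card_{\ell_k}(P_j')=\mu\}$. Set $q^m_{f_0(k,i)}=\ell_k$ for $i\le\mu$ and $q^m_{f_0(k,i)}=1$ for $i>\mu$. For every $j\in J$ with $P_m\le P_j$ set $q^j_{f_0(k,i)}=q^m_{f_0(k,i)}$ for all $i$. Remove from $J$ the indices now treated and repeat until $J$ is empty. Sequences $P_1,\dots,P_n$ are properly arranged if they equal their proper arrangement; here this is applied to the pair $P,Q$. *)

(* Defs.v *)
(* MathComp / MathComp-Analysis *)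
From HB Require Import structures.
From mathcomp Require Import all_boot all_order all_algebra.
From mathcomp Require Import generic_quotient ring_quotient archimedean.
From mathcomp Require Import all_classical all_reals all_analysis.

Set Implicit Arguments.
Unset Strict Implicit.
Unset Printing Implicit Defensive.

Import Order.TTheory GRing.Theory Num.Theory.
Import numFieldNormedType.Exports.

Local Open Scope classical_set_scope.
Local Open Scope card_scope.
Local Open Scope ring_scope.

(** Sequences indexed by 1, 2, 3, ... in the mathematics are functions on [nat]
    here, the term of index [j] being the value at [j.-1]. *)

Section Torus.
Variable R : realType.

Definition integers : zmodClosed R :=
  GRing.ZmodClosed.clone R (@Num.int_num_subdef R) _.

(** R / Z: the group is the quotient of [R] by the subgroup of integers, the
    topology is the quotient topology. *)
Definition circle : Type := quotient_topology {ideal_quot integers}.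

HB.instance Definition _ := Topological.on circle.
HB.instance Definition _ := GRing.Zmodule.copy circle {ideal_quot integers}.

Definition circle_proj (x : R) : circle := (\pi_({ideal_quot integers}) x)%qT.

Lemma circle_projB : {morph circle_proj : x y / x - y}.
Proof.
move=> x y; rewrite /circle_proj.
exact: (@GRing.raddfB _ _ (\pi_({ideal_quot integers}))%qT).
Qed.

HB.instance Definition _ :=
  GRing.isZmodMorphism.Build R circle circle_proj circle_projB.

(** Elements of R^n and of T^n are column vectors. *)
Definition torus (n : nat) : Type := 'cV[circle]_n.

HB.instance Definition _ n := Topological.on (torus n).
HB.instance Definition _ n := GRing.Zmodule.on (torus n).

Definition torus_proj n (t : 'cV[R]_n) : torus n := map_mx circle_proj t.

(** The endomorphism [f] of T^n with [f (p^n t) = p^n (M t)]; see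
    [torus_mul_proj]. *)
Definition torus_mul n (M : 'M[int]_n) (x : torus n) : torus n :=
  \col_i \sum_k x k 0 *~ M i k.

Lemma torus_mul_proj n (M : 'M[int]_n) (t : 'cV[R]_n) :
  torus_mul M (torus_proj t) = torus_proj (map_mx intr M *m t).
Proof.
apply/colP => i; rewrite !mxE raddf_sum; apply: eq_bigr => k _.
by rewrite !mxE -raddfMz mulrzl.
Qed.

Lemma torus_mulB n (M : 'M[int]_n) : {morph torus_mul M : x y / x - y}.
Proof.
move=> x y; apply/colP => i; rewrite !mxE -sumrB.
by apply: eq_bigr => k _; rewrite !mxE mulrzBl.
Qed.

(** The product of countably many copies of T^n. *)
Definition torus_seq (n : nat) : Type :=
  prod_topology (fun _ : nat => torus n).

HB.instance Definition _ n := Topological.on (torus_seq n).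
HB.instance Definition _ n := GRing.Zmodule.copy (torus_seq n) (nat -> torus n).

End Torus.

(** Sequences of integer matrices with non-zero determinants. *)
Record mxseq (n : nat) := MxSeq {
  mxs :> nat -> 'M[int]_n;
  mxsP : forall j, \det (mxs j) != 0
}.

Section Solenoid.
Variables (R : realType) (n : nat) (M : mxseq n).

Definition solenoid_set : set (torus_seq R n) :=
  [set x | forall j, x j = torus_mul (M j) (x j.+1)].

Definition solenoid_pred : pred (torus_seq R n) := fun x => x \in solenoid_set.

Lemma solenoid_zmod_closed : zmod_closed solenoid_pred.
Proof.
split=> [|x y].
  apply: mem_set => j; apply/colP => i; rewrite !mxE big1 // => k _.
  by rewrite mxE mul0rz.
move=> /set_mem hx /set_mem hy; apply: mem_set => j.
by rewrite torus_mulB -hx -hy.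
Qed.

HB.instance Definition _ :=
  GRing.isZmodClosed.Build _ solenoid_pred solenoid_zmod_closed.

(** The topology is the one induced by the product topology, the group law is
    coordinatewise. *)
Definition solenoid : Type := {x : torus_seq R n | solenoid_pred x}.

HB.instance Definition _ := Topological.copy solenoid (set_type solenoid_set).
HB.instance Definition _ := SubChoice.on solenoid.
HB.instance Definition _ := [SubChoice_isSubZmodule of solenoid by <:].

(** The product of the inverses of the first [j] matrices, the first matrix
    acting first. *)
Fixpoint inv_prod (j : nat) : 'M[R]_n :=
  if j is i.+1 then invmx (map_mx intr (M i)) *m inv_prod i else 1%:M.

Definition pi_seq (t : 'cV[R]_n) : torus_seq R n :=
  fun j => torus_proj (inv_prod j *m t).

Lemma pi_seq_solenoid t : solenoid_pred (pi_seq t).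
Proof.
apply: mem_set => j; rewrite /pi_seq torus_mul_proj /= !mulmxA.
rewrite mulmxV ?mul1mx //.
by rewrite unitmxE unitfE det_map_mx intr_eq0 mxsP.
Qed.

Definition sol_pi (t : 'cV[R]_n) : solenoid :=
  Sub (pi_seq t) (pi_seq_solenoid t).

End Solenoid.

(** * Flows and their equivalences *)

Definition homeomorphism (X Y : topologicalType) (h : X -> Y) : Prop :=
  continuous h /\
  exists g : Y -> X, [/\ continuous g, cancel h g & cancel g h].

(** Homomorphisms of topological groups are continuous; "increasing" is read
    strictly. *)
Definition increasing_hom (R : realType) (alpha : R -> R) : Prop :=
  [/\ {morph alpha : s t / s + t},
      {homo alpha : s t / s < t} &
      continuous alpha].

Definition flow_equivalence (R : realType) (X Y : topologicalType)
    (alpha : R -> R) (h : X -> Y)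
    (phi : R -> X -> X) (psi : R -> Y -> Y) : Prop :=
  [/\ increasing_hom alpha,
      homeomorphism h &
      forall t x, h (phi t x) = psi (alpha t) (h x)].

Definition equivalent_flows (R : realType) (X Y : topologicalType)
    (phi : R -> X -> X) (psi : R -> Y -> Y) : Prop :=
  exists (alpha : R -> R) (h : X -> Y), flow_equivalence alpha h phi psi.

Definition linear_flow (R : realType) (n : nat) (M : mxseq n) (w : 'cV[R]_n)
    (t : R) (x : solenoid R M) : solenoid R M := sol_pi M (t *: w) + x.
Arguments linear_flow {R n} M w t x.

Definition irrational_direction (R : realType) (w : 'cV[R]_2) : Prop :=
  forall k1 k2 : int,
    k1%:~R * w 0 0 + k2%:~R * w 1 0 = 0 -> k1 = 0 /\ k2 = 0.

Definition automorphism (R : realType) (n : nat) (M : mxseq n)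
    (h : solenoid R M -> solenoid R M) : Prop :=
  {morph h : x y / x + y} /\ homeomorphism h.

Definition represents (R : realType) (n : nat) (M : mxseq n) (A : 'M[R]_n)
    (h : solenoid R M -> solenoid R M) : Prop :=
  forall t : 'cV[R]_n, h (sol_pi M t) = sol_pi M (A *m t).

(** * Sequences of non-zero integers and multipliers *)

Record nzseq := NzSeq {
  nzs :> nat -> int;
  nzsP : forall j, nzs j != 0
}.

Lemma scalar_mxseq_det (P : nzseq) j : \det ((P j)%:M : 'M[int]_1) != 0.
Proof. by rewrite det_scalar1 nzsP. Qed.

Definition scalar_mxseq (P : nzseq) : mxseq 1 :=
  MxSeq (scalar_mxseq_det P).

(** The matrix diag(p, q). *)
Definition diag2 (p q : int) : 'M[int]_2 :=
  block_mx p%:M 0 0 q%:M : 'M[int]_(1 + 1).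

Lemma diag_mxseq_det (P Q : nzseq) j : \det (diag2 (P j) (Q j)) != 0.
Proof.
by rewrite [\det _](@det_ublock _ 1 1) !det_scalar1 mulf_neq0 ?nzsP.
Qed.

Definition diag_mxseq (P Q : nzseq) : mxseq 2 := MxSeq (diag_mxseq_det P Q).

(** The matrix with rows (a, 0) and (c, d). *)
Definition lower2 (R : realType) (a c d : R) : 'M[R]_2 :=
  block_mx a%:M 0 c%:M d%:M : 'M[R]_(1 + 1).

Definition sol1_pi (R : realType) (P : nzseq) (s : R) :
    solenoid R (scalar_mxseq P) :=
  sol_pi (scalar_mxseq P) (const_mx s).

(** The path component of the identity. *)
Definition C_ (R : realType) (P : nzseq) : set (solenoid R (scalar_mxseq P)) :=
  range (@sol1_pi R P).
Arguments C_ {R} P _.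

(** The parameter set on which [sol1_pi P] is a bijection onto [C_ P], for a
    sequence [P] of positive integers: [0, p) with p the product of all terms
    if [P] is eventually 1 (the product of the first [N] terms then does not
    depend on the choice of [N]), all of [R] otherwise. *)
Definition param_dom (R : realType) (P : nzseq) : set R :=
  [set s | forall N : nat, (forall j, (N <= j)%N -> P j = 1) ->
     0 <= s < (\prod_(j < N) P j)%:~R].

Definition multiplier_map (R : realType) (r : R) (P Q : nzseq)
    (x : solenoid R (scalar_mxseq P)) : solenoid R (scalar_mxseq Q) :=
  sol1_pi Q (r * get [set s | param_dom P s /\ sol1_pi P s = x]).

Arguments multiplier_map {R} r P Q x.

(** [C_ P] and [C_ Q] carry the subspace topology; the values of the map are
    in [C_ Q] by construction. *)
Definition proper_multiplier (R : realType) (P Q : nzseq) (r : R) : Prop :=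
  {within C_ P, continuous (multiplier_map r P Q)} /\
  (forall x y : solenoid R (scalar_mxseq P), C_ P x -> C_ P y ->
     multiplier_map r P Q (x + y) =
     multiplier_map r P Q x + multiplier_map r P Q y).

(** [r != 0] makes 1 / r meaningful. *)
Definition iso_multiplier (R : realType) (P : nzseq) (r : R) : Prop :=
  [/\ r != 0, proper_multiplier P P r & proper_multiplier P P (1 / r)].

(** * Order and proper arrangement *)

(** The prime factors of |p|, with multiplicity and in increasing order;
    the one-term sequence 1 if |p| = 1. *)
Definition factors (p : int) : seq nat :=
  if `|p|%N == 1%N then [:: 1%N]
  else flatten [seq nseq f.2 f.1 | f <- prime_decomp `|p|%N].

(** Each of the first [k.+1] blocks is non-empty, so that together they reach
    position [k]. *)
Definition derived (P : nzseq) (k : nat) : nat :=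
  nth 0%N (flatten [seq factors (P j) | j <- iota 0 k.+1]) k.

Definition occ (q : nat) (P : nzseq) : set nat := [set k | derived P k = q].

(** [D] is the set of positions of the deleted terms. *)
Definition le_seq (P Q : nzseq) : Prop :=
  exists D : set nat, finite_set D /\
    forall q : nat, prime q -> occ q P `\` D #<= occ q Q.

Definition gt_seq (P Q : nzseq) : Prop := le_seq Q P /\ ~ le_seq P Q.

(** [k] and [i] start from 1. *)
Definition f0 (k i : nat) : nat := (((k + i - 2) * (k + i - 1))./2 + i)%N.

Lemma next_prime_ex (m : nat) : exists p : nat, (m < p)%N && prime p.
Proof. by have [p lt_mp pr_p] := prime_above m; exists p; apply/andP. Qed.

Definition next_prime (m : nat) : nat := ex_minn (next_prime_ex m).

(** [nth_prime 1 = 2], [nth_prime 2 = 3], and so on. *)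
Definition nth_prime (k : nat) : nat := iter k next_prime 0%N.

Section Arrangement.
Variables (n : nat) (P : 'I_n -> nzseq).

Definition max_card (l : nat) (J : {set 'I_n}) (m : 'I_n) : Prop :=
  m \in J /\ forall j, j \in J -> occ l (P j) #<= occ l (P m).

Definition least_max (l : nat) (J : {set 'I_n}) (m : 'I_n) : Prop :=
  max_card l J m /\ forall j, max_card l J j -> (m <= j)%N.

(** [leader l #|J| J j] is the index [m] chosen in the round in which [j] is
    removed, when the procedure for the prime [l] is started with index set
    [J]; at least one index is removed in each round. *)
Fixpoint leader (l rounds : nat) (J : {set 'I_n}) (j : 'I_n) : 'I_n :=
  if rounds is r.+1 then
    if [pick m | `[< least_max l J m >]] is Some m then
      if `[< le_seq (P m) (P j) >] then m
      else leader l r [set j' in J | ~~ `[< le_seq (P m) (P j') >]] j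
    else j
  else j.

(** Index [i] satisfies i <= card(A) exactly when [`I_i #<= A]. *)
Definition arranged_term (j : 'I_n) (k i : nat) : int :=
  let l := nth_prime k in
  if `I_i #<= occ l (P (leader l n [set: 'I_n] j)) then l%:Z else 1.

Definition proper_arrangement (q : 'I_n -> nat -> int) : Prop :=
  forall (j : 'I_n) (k i : nat), (0 < k)%N -> (0 < i)%N ->
    q j (f0 k i).-1 = arranged_term j k i.

Definition properly_arranged : Prop :=
  proper_arrangement (fun j => P j).

End Arrangement.

Definition properly_arranged_pair (P Q : nzseq) : Prop :=
  properly_arranged (tnth [tuple P; Q]).

(* Main.v *)
Require Import Defs.
From mathcomp Require Import all_boot all_order all_algebra.
From mathcomp Require Import archimedean generic_quotient ring_quotient.
From mathcomp Require Import ring lra zify.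
From mathcomp Require Import all_classical all_reals all_analysis.
Import Order.TTheory GRing.Theory Num.Theory.
Import numFieldNormedType.Exports.
Local Open Scope classical_set_scope.
Local Open Scope ring_scope.
Set Implicit Arguments.
Unset Strict Implicit.

(** Let [h] be the homeomorphism of the given equivalence, and let [H] be
    [h - h 0]. Since [h] intertwines the two flows, [H (x + y) = H x + H y]
    whenever [x] lies on the orbit of 0. An irrational orbit is dense
    ([irrational_orbit_dense]: a neighbourhood depends on finitely many levels,
    and on one level this is Kronecker's theorem), so [H] is an automorphism
    ([equivalence_hom]), and it is an equivalence of the two flows with the
    same time change as [h].

    Continuous homomorphisms from the line to the circle lift to linear maps
    ([circle_hom_lift]). Level by level, this gives a real matrix [A] that
    represents [H], and a matrix that represents the inverse of [H]
    ([continuous_hom_mx]); they are inverse to each other.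

    The solenoid of the matrices diag(p_j, q_j) is the product of the solenoids
    of [P] and [Q], so each entry of these matrices is multiplication by a real
    number that extends to a continuous homomorphism between two of the
    one-dimensional solenoids ([entry_hom]), and such a number is a proper
    multiplier ([proper_multiplier_hom]). For the diagonal entries and the
    lower left entries of [A] and its inverse these are the required
    properties: the lower left entry of the inverse is [- c / (a * d)].

    The upper right entry [b] of [A] is 0, because a non-zero one would give
    [P <= Q]. Indeed a continuous homomorphism from the solenoid of [Q] to that
    of [P] which multiplies by [b] maps the deep levels of its source to
    subgroups contained in a small arc, which are trivial; hence for each [j]
    some [b * (q_1 ... q_N)] is an integer multiple of [p_1 ... p_j]
    ([hom_integral]). The terms of properly arranged sequences are primes and
    ones, so that divisibility counts occurrences of primes and gives [P <= Q]
    ([le_seq_dvd], [hom_le_seq]). *)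

(** * The circle *)

Lemma exp2_large (R : realType) (x : R) : exists n, x < 2 ^+ n.
Proof.
exists (Num.bound x); apply: le_lt_trans (ler_norm x) _.
rewrite /Num.bound -natrX; apply: lt_trans (real_truncnS_gt _) _.
  by rewrite num_real.
by rewrite ltr_nat ltn_expl.
Qed.

Section Circle.
Variable R : realType.
Implicit Types (c : circle R) (e s t : R).

Lemma circle_proj_surj c : exists s, circle_proj s = c.
Proof. by exists (repr c); exact: (@reprK R {ideal_quot (integers R)} c). Qed.

Lemma circle_proj_eq0 s : circle_proj s = 0 <-> s \is a Num.int.
Proof.
have := @Quotient.idealrBE R (integers R) s 0; rewrite subr0 => e.
rewrite -[_ \is a _]/(s \in integers R) e.
have <- : circle_proj (0 : R) = 0 by exact: raddf0.
by split=> [h|/eqP //]; apply/eqP.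
Qed.

Lemma circle_proj_int (k : int) : circle_proj (k%:~R : R) = 0.
Proof. by apply/circle_proj_eq0; exact: intr_int. Qed.

Definition circle_arc e : set (circle R) :=
  [set circle_proj t | t in [set t | `|t| < e]].

(** The saturation of an open set is a union of its integer translates. *)
Lemma open_circle_proj (O : set R) : open O -> open (@circle_proj R @` O).
Proof.
move=> Oo; rewrite /open/= /quotient_open openE => x /= [z Oz oxE].
have /nbhs_ballP[e /= e0 eO] : nbhs z O by exact: open_nbhs_nbhs.
apply/nbhs_ballP; exists e => //= y xy; exists (z + (y - x)).
  by apply: eO; move: xy; rewrite /ball /= opprD addNKr opprB.
rewrite !raddfD /= oxE raddfN /= addrC; exact: subrK.
Qed.

Lemma continuous_circle_proj : continuous (@circle_proj R).
Proof. exact: pi_continuous. Qed.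

(** This and [cvg_circleP] replace a metric on the quotient: every later
    topological argument is a computation with the arcs [circle_arc e]. *)
Lemma nbhs_circleP c (U : set (circle R)) :
  nbhs c U <-> exists2 e, 0 < e & forall d, circle_arc e d -> U (c + d).
Proof.
have [s <-] := circle_proj_surj c; split.
  move=> /continuous_circle_proj /nbhs_ballP [e /= e0 eU].
  exists e => // d [t te <-].
  rewrite -raddfD; apply: eU; rewrite /ball /= opprD addNKr normrN//.
move=> [e e0 eU]; have : open_nbhs (circle_proj s) (@circle_proj R @` (ball s e)).
  split; first by apply: open_circle_proj; exact: ball_open.
  by exists s => //; exact: ballxx.
move=> /open_nbhs_nbhs; apply: filterS => _ [t st <-].
rewrite -[t](subrK s) raddfD /= addrC; apply: eU; exists (t - s) => //=.
by rewrite distrC.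
Qed.

Lemma cvg_circleP {T : Type} (F : set_system T) {FF : Filter F}
    (f : T -> circle R) c :
  f @ F --> c <-> forall e, 0 < e -> \forall x \near F, circle_arc e (f x - c).
Proof.
split=> [fc e e0|H U /nbhs_circleP[e e0 eU]].
  apply: (fc [set d | circle_arc e (d - c)]); apply/nbhs_circleP.
  exists e => // d ad.
  by rewrite /= addrAC subrr add0r.
apply: filterS (H e e0) => x /eU; rewrite addrC subrK //.
Qed.

Lemma circle_arcD e1 e2 c d :
  circle_arc e1 c -> circle_arc e2 d -> circle_arc (e1 + e2) (c + d).
Proof.
move=> [s se <-] [t te <-]; exists (s + t); rewrite ?raddfD //=.
by apply: le_lt_trans (ler_normD _ _) (ltrD _ _).
Qed.

Lemma circle_arcN e c : circle_arc e c -> circle_arc e (- c).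
Proof. by move=> [s se <-]; exists (- s); rewrite ?raddfN //= normrN. Qed.

Lemma circle_arc_mono e1 e2 c : e1 <= e2 -> circle_arc e1 c -> circle_arc e2 c.
Proof. by move=> e12 [s se <-]; exists s => //=; exact: lt_le_trans e12. Qed.

(** Two distinct representatives of a class differ by at least 1. *)
Lemma circle_arc_lift_inj s t : `|s| < 2^-1 -> `|t| < 2^-1 ->
  circle_proj s = circle_proj t -> s = t.
Proof.
move=> s2 t2 ste; have /circle_proj_eq0 st : circle_proj (s - t) = 0.
  by rewrite raddfB /= ste subrr.
apply/eqP; rewrite -subr_eq0; apply: contraT => st0.
have := norm_intr_ge1 st st0; have := ler_normB s t.
by move: s2 t2; lra.
Qed.

(** The circle is a Hausdorff space. *)
Lemma circle_eq0 c : (forall e, 0 < e -> circle_arc e c) -> c = 0.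
Proof.
move=> H; have [|s s1] := H (2^-1); first by rewrite invr_gt0.
move=> sE; rewrite -sE; have [->|s0] := eqVneq s 0; first exact: raddf0.
have [|t] := H (Num.min `|s| 2^-1).
  by rewrite lt_min normr_gt0 s0 invr_gt0 ltr0n.
rewrite /= lt_min => /andP[ts t1] cE.
by rewrite (circle_arc_lift_inj t1 s1 (etrans cE (esym sE))) ltxx in ts.
Qed.

Lemma cvg_circleD {T : Type} (F : set_system T) {FF : Filter F}
    (f g : T -> circle R) c d :
  f @ F --> c -> g @ F --> d -> (fun x => f x + g x) @ F --> c + d.
Proof.
move=> /cvg_circleP fc /cvg_circleP gd; apply/cvg_circleP => e e0.
have e2 : 0 < e / 2 by rewrite divr_gt0.
apply: filterS2 (fc _ e2) (gd _ e2) => x h1 h2.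
by rewrite opprD addrACA [e]splitr; exact: circle_arcD.
Qed.

Lemma cvg_circleN {T : Type} (F : set_system T) {FF : Filter F}
    (f : T -> circle R) c :
  f @ F --> c -> (fun x => - f x) @ F --> - c.
Proof.
move=> /cvg_circleP fc; apply/cvg_circleP => e e0.
by apply: filterS (fc _ e0) => x /circle_arcN; rewrite opprD.
Qed.

(** Near 0 the values of [f] have small representatives, and halving the
    argument halves the small representative. So [f] agrees with a linear map
    on the dyadic multiples of some [d'], hence everywhere by continuity. *)
Lemma circle_hom_lift (f : R -> circle R) :
  {morph f : x y / x + y} -> continuous f ->
  exists a, forall t, f t = circle_proj (a * t).
Proof.
move=> fD fc.
have f0 : f 0 = 0 by apply: (@addrI _ (f 0)); rewrite -fD !addr0.
have fN t : f (- t) = - f t.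
  by apply: (@addrI _ (f t)); rewrite -fD !subrr.
have fMn t (m : nat) : f (t *+ m) = f t *+ m.
  by elim: m => [|m IH]; rewrite ?mulr0n// !mulrS fD IH.
have fMz t (m : int) : f (t *~ m) = f t *~ m.
  case: m => m; first exact: fMn.
  by rewrite !NegzE !mulrNz fN; congr (- _); exact: fMn.
have [d d0 fd] : exists2 d, 0 < d & forall t, `|t| < d -> circle_arc 4^-1 (f t).
  have /cvg_circleP/(_ 4^-1) := fc 0; rewrite f0 invr_gt0 ltr0n => /(_ isT).
  move=> /nbhs_ballP[d /= d0 H]; exists d => // t td.
  by have := H t; rewrite /ball /= sub0r normrN => /(_ td); rewrite subr0.
pose d' := d / 2; have d'0 : 0 < d' by rewrite divr_gt0.
have d'd : `|d'| < d by rewrite gtr0_norm // /d'; move: d0; lra.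
have [b /= b4 fb] := fd _ d'd.
have fdyadic n : f (d' / 2 ^+ n) = circle_proj (b / 2 ^+ n) /\
    `|b / 2 ^+ n| < 4^-1.
  elim: n => [|n [IH1 IH2]]; first by rewrite expr0 !divr1.
  have h (x : R) : x / 2 ^+ n.+1 = (x / 2 ^+ n) / 2.
    by rewrite exprSr invfM mulrA.
  rewrite !h; set y := b / 2 ^+ n in IH1 IH2 *; set u := d' / 2 ^+ n in IH1 *.
  have ud : `|u / 2| < d.
    have u0 : 0 < u by rewrite divr_gt0 ?exprn_gt0 ?ltr0n.
    have : u <= d'.
      rewrite ler_pdivrMr ?exprn_gt0 ?ltr0n //.
      by rewrite ler_peMr ?exprn_ege1 ?ler1n // ltW.
    by rewrite gtr0_norm ?divr_gt0 //; rewrite /d' in d'0 *; move: d0 u0; lra.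
  have [z /= z4 fz] := fd _ ud.
  suff -> : y / 2 = z by [].
  have : circle_proj (z + z) = circle_proj y.
    by rewrite raddfD /= fz -fD -splitr.
  move=> /circle_arc_lift_inj <-; [by field| |by move: IH2; lra].
  have := ler_normD z z; move: z4; lra.
(* [g] is continuous and vanishes on the multiples of every [d' / 2 ^+ n]. *)
pose g t := f t - circle_proj (b / d' * t).
have gc : g @ (0 : R) --> g 0.
  apply: cvg_circleD; first exact: fc.
  apply: cvg_circleN.
  apply: (@continuous_comp _ _ _ ( *%R (b / d')) (@circle_proj R) (0 : R)).
    exact: mulrl_continuous.
  exact: continuous_circle_proj.
have g0 : g 0 = 0 by rewrite /g f0 mulr0 raddf0 subr0.
exists (b / d') => t; apply/subr0_eq/circle_eq0 => e e0.
have [r r0 gr] : exists2 r, 0 < r & forall t, `|t| < r -> circle_arc e (g t).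
  move/cvg_circleP : gc => /(_ e e0); rewrite g0.
  move=> /nbhs_ballP[r /= r0 H]; exists r => // x xr.
  by have := H x; rewrite /ball /= sub0r normrN => /(_ xr); rewrite subr0.
have [n nr] : exists n, d' / 2 ^+ n < r.
  have [n nr] := exp2_large (d' / r); exists n.
  by rewrite ltr_pdivrMr ?exprn_gt0 ?ltr0n // mulrC -ltr_pdivrMr.
set u := d' / 2 ^+ n in nr.
have u0 : 0 < u by rewrite divr_gt0 ?exprn_gt0 ?ltr0n.
pose k := Num.floor (t / u).
suff -> : f t - circle_proj (b / d' * t) = g (t - u *~ k).
  apply: gr; apply: le_lt_trans nr.
  have /andP[] : k%:~R <= t / u < (k + 1)%:~R by exact: floor_itv.
  rewrite ler_pdivlMr // ltr_pdivrMr // intrD mulrDl mul1r mulrzl => h1 h2.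
  by rewrite ger0_norm ?subr_ge0 // lerBlDl ltW.
have fu : f (u *~ k) = circle_proj (b / d' * (u *~ k)).
  rewrite fMz (fdyadic n).1 -raddfMz /=; congr circle_proj.
  by rewrite mulrzAr /u mulrA divfK // gt_eqF.
by rewrite /g fD fN fu mulrBr raddfB /= opprB addrA subrK.
Qed.
End Circle.

(** A representative in the arc that stays there under repeated doubling is 0. *)
Lemma circle_no_small_subgroup (R : realType) (c : circle R) :
  (forall m : nat, circle_arc 4^-1 (c *+ m)) -> c = 0.
Proof.
move=> small; have [s s4 sc] := small 1%N; rewrite mulr1n in sc.
have double n : `|2 ^+ n * s| < 4^-1 /\ circle_proj (2 ^+ n * s) = c *+ 2 ^ n.
  elim: n => [|n [IH1 IH2]]; first by rewrite expr0 mul1r expn0 mulr1n.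
  have [t /= t4 tc] := small (2 ^ n.+1)%N.
  have h : 2 ^+ n.+1 * s = 2 ^+ n * s + 2 ^+ n * s by rewrite exprS; ring.
  rewrite h; set y := 2 ^+ n * s in IH1 IH2 *.
  have e : circle_proj (y + y) = circle_proj t.
    by rewrite raddfD /= IH2 tc expnS mul2n -addnn mulrnDr.
  rewrite (circle_arc_lift_inj _ _ e) //; last by move: t4; lra.
  by have := ler_normD y y; move: IH1; lra.
rewrite -sc; have [->|s0] := eqVneq s 0; first exact: raddf0.
have [n] := exp2_large (`|s|^-1).
rewrite -[X in X < _]mul1r ltr_pdivrMr ?normr_gt0 // => h.
have [+ _] := double n; rewrite normrM (ger0_norm (exprn_ge0 _ _)) // => h'.
by exfalso; move: h h'; lra.
Qed.

Lemma circle_fun_dense0 (R : realType) (X : topologicalType) (f : X -> circle R)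
    (D : set X) :
  dense D -> continuous f -> (forall x, D x -> f x = 0) -> forall x, f x = 0.
Proof.
move=> Dd fc fD x; apply: circle_eq0 => e e0.
have /cvg_circleP/(_ e e0) := fc x.
rewrite nbhsE => -[U [oU Ux] UA].
have [|y [/UA /= yA Dy]] := Dd U _ oU; first by exists x.
by move: yA; rewrite (fD _ Dy) sub0r => /circle_arcN; rewrite opprK.
Qed.

(** * The topology of solenoids *)

Section SolenoidTopology.
Variables (R : realType) (n : nat) (M : mxseq n).
Local Notation Sol := (solenoid R M).

Definition sol_coord j i (x : Sol) : circle R := val x j i 0.

Lemma sol_coordB j i : {morph sol_coord j i : x y / x - y}.
Proof. by move=> x y; rewrite /sol_coord !mxE. Qed.

Lemma sol_coordD j i : {morph sol_coord j i : x y / x + y}.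
Proof. by move=> x y; rewrite /sol_coord !mxE. Qed.

Lemma sol_coord0 j i : sol_coord j i 0 = 0.
Proof. by rewrite /sol_coord !mxE. Qed.

Lemma sol_coord_inj (x y : Sol) :
  (forall j i, sol_coord j i x = sol_coord j i y) -> x = y.
Proof.
by move=> h; apply: val_inj; apply: funext => j; apply/colP => i; exact: h.
Qed.

Lemma sol_coord_pi j i t :
  sol_coord j i (sol_pi M t) = circle_proj ((inv_prod R M j *m t) i 0).
Proof. by rewrite /sol_coord /= /pi_seq !mxE. Qed.

(** With [continuous_sol_coord], the topology of a solenoid is the one induced
    by its circle-valued coordinates, so that continuity and convergence are
    checked in the circle. *)
Lemma cvg_solenoid (T : Type) (F : set_system T) {FF : Filter F}
    (f : T -> Sol) (y : Sol) :
  (forall j i, (fun x => sol_coord j i (f x)) @ F --> sol_coord j i y) ->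
  f @ F --> y.
Proof.
move=> H; have vf : (val \o f : T -> torus_seq R n) @ F -->
    (val y : torus_seq R n).
  apply/cvg_sup => j U [_ [[W oW <-] Wy WU]].
  have : nbhs (val y j) W by exact: open_nbhs_nbhs.
  move=> [P Py PW].
  have : \forall x \near F,
      forall ik : 'I_n * 'I_1, P ik.1 ik.2 (val (f x) j ik.1 ik.2).
    apply: filter_forall => -[i k] /=.
    by rewrite (ord1 k); apply: (H j i) (P i 0) _; exact: Py.
  by apply: filterS => x Px; apply: WU; apply: PW => i k; exact: (Px (i, k)).
move=> U [_ [[W oW <-] Wy WU]].
by apply: filterS WU _; apply: vf; exact: open_nbhs_nbhs.
Qed.

Lemma continuous_sol_coord j i : continuous (sol_coord j i).
Proof.
move=> x U Ux; have [V [oV Vx VU]] : exists V,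
    [/\ open V, V (val x j : torus R n) & V `<=` [set y | U (y i 0)]].
  have : nbhs (val x j : torus R n) [set y | U (y i 0)].
    exists (fun i' k => if i' == i then U else setT) => [i' k|y /(_ i 0)].
      by case: eqP => [->|_]; [rewrite (ord1 k)|exact: filterT].
    by rewrite eqxx.
  by rewrite nbhsE => -[V [oV Vx] VU]; exists V.
suff : nbhs x [set z : Sol | V (val z j)] by apply: filterS => z /VU.
have : nbhs (val x : torus_seq R n) [set z | V (z j)].
  have /cvg_sup/(_ j) : nbhs (val x : torus_seq R n) -->
    (val x : torus_seq R n) by exact: cvg_id.
  by apply; apply: open_nbhs_nbhs; split => //; exists V.
rewrite nbhsE => -[W [oW Wx] WV].
have : open_nbhs x [set z : Sol | W (val z)] by split => //; exists W.
by move=> /open_nbhs_nbhs; apply: filterS => z /WV.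
Qed.
End SolenoidTopology.

Lemma continuous_sol_coord_comp (R : realType) n (M : mxseq n) (X : topologicalType)
    (f : X -> solenoid R M) j i :
  continuous f -> continuous (fun x => sol_coord j i (f x)).
Proof.
move=> fc x; apply: (@continuous_comp _ _ _ f (sol_coord j i)); first exact: fc.
exact: continuous_sol_coord.
Qed.

Lemma continuous_solenoid (R : realType) n (M : mxseq n) (X : topologicalType)
    (f : X -> solenoid R M) :
  (forall j i, continuous (fun x => sol_coord j i (f x))) -> continuous f.
Proof. by move=> fc x; apply: cvg_solenoid => j i; exact: fc. Qed.

Section Basis.
Variables (R : realType) (n : nat) (M : mxseq n).
Local Notation Sol := (solenoid R M).

(** The neighbourhoods of [x] contain basic ones: those given by arcs on the
    finitely many levels up to some [N]. *)
Lemma nbhs_solenoid (x : Sol) (U : set Sol) : nbhs x U ->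
  exists (N : nat) (e : R), 0 < e /\ forall y, (forall j i, (j <= N)%N ->
    circle_arc e (sol_coord j i y - sol_coord j i x)) -> U y.
Proof.
pose B (p : nat * R) := [set y : Sol | forall j i, (j <= p.1)%N ->
  circle_arc p.2 (sol_coord j i y - sol_coord j i x)].
pose G := filter_from [set p : nat * R | 0 < p.2] B.
have GF : Filter G.
  apply: filter_from_filter; first by exists (0%N, 1) => /=.
  move=> [N1 e1] [N2 e2] /= e10 e20; exists (maxn N1 N2, Num.min e1 e2).
    by rewrite /= lt_min e10.
  move=> y yB; split=> j i jN.
    apply: circle_arc_mono (yB j i _); first by rewrite /= ge_min lexx.
    by rewrite /= leq_max jN.
  apply: circle_arc_mono (yB j i _); first by rewrite /= ge_min lexx orbT.
  by rewrite /= leq_max jN orbT.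
have Gx : id @ G --> x.
  apply: cvg_solenoid => j i; apply/cvg_circleP => e e0.
  by exists (j, e) => // y; apply.
by move=> /Gx [[N e] /= e0 BU]; exists N, e.
Qed.
End Basis.

Lemma continuous_solenoid_add (R : realType) n (M : mxseq n)
    (X : topologicalType) (f g : X -> solenoid R M) :
  continuous f -> continuous g -> continuous (fun x => f x + g x).
Proof.
move=> fc gc; apply: continuous_solenoid => j i x.
under eq_fun do rewrite sol_coordD.
by apply: cvg_circleD; exact: continuous_sol_coord_comp.
Qed.

Lemma continuous_solenoid_opp (R : realType) n (M : mxseq n)
    (X : topologicalType) (f : X -> solenoid R M) :
  continuous f -> continuous (fun x => - f x).
Proof.
move=> fc; apply: continuous_solenoid => j i x.
have cN y : sol_coord j i (- y : solenoid R M) = - sol_coord j i y.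
  by rewrite -sub0r sol_coordB sol_coord0 sub0r.
under eq_fun do rewrite cN.
by apply: cvg_circleN; exact: continuous_sol_coord_comp.
Qed.

(** * Continuous homomorphisms are linear on the image of the Euclidean space *)

Section OneParameter.
Variables (R : realType) (n : nat) (M : mxseq n).
Local Notation Sol := (solenoid R M).

Lemma sol_piD : {morph sol_pi M : s t / s + t >-> s + t :> Sol}.
Proof.
move=> s t; apply: sol_coord_inj => j i.
by rewrite sol_coordD !sol_coord_pi mulmxDr mxE raddfD.
Qed.

Lemma sol_pi0 : sol_pi M 0 = 0 :> Sol.
Proof. by apply: (@addrI _ (sol_pi M 0)); rewrite -sol_piD !addr0. Qed.

Lemma sol_piN t : sol_pi M (- t) = - sol_pi M t :> Sol.
Proof. by apply: (@addrI _ (sol_pi M t)); rewrite -sol_piD !subrr sol_pi0. Qed.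

Lemma continuous_sol_pi_line (v : 'cV[R]_n) :
  continuous (fun t : R => sol_pi M (t *: v)).
Proof.
move=> t; apply: cvg_solenoid => j i.
set c := fun j i => (inv_prod R M j *m v) i 0.
have lin s : sol_coord j i (sol_pi M (s *: v)) =
    circle_proj (c j i * s).
  by rewrite sol_coord_pi -scalemxAr mxE mulrC.
under eq_fun do rewrite lin.
rewrite lin.
apply: (@continuous_comp _ _ _ ( *%R (c j i)) (@circle_proj R) t).
  exact: mulrl_continuous.
exact: continuous_circle_proj.
Qed.

Lemma circle_proj_lin_inj (a b : R) :
  (forall t, circle_proj (a * t) = circle_proj (b * t)) -> a = b.
Proof.
move=> ab; apply/eqP; rewrite -subr_eq0; apply: contraT => c0.
(* At this point the two sides would differ by the class of 1/2. *)
have := ab (2 * (a - b))^-1.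
move/(congr1 (fun x => x - circle_proj (b * (2 * (a - b))^-1))).
rewrite subrr -raddfB /= -mulrBl invfM mulrCA divff // mulr1 => /circle_proj_eq0.
move=> /norm_intr_ge1; rewrite invr_eq0 pnatr_eq0 => /(_ isT).
by rewrite gtr0_norm ?invr_gt0 ?ltr0n // invf_ge1 ?ltr0n // lern1.
Qed.

(** The coordinates lift one by one to linear maps; the relations between
    consecutive levels hold for the lifts because a linear map is determined
    by its reduction mod 1. *)
Lemma solenoid_hom_lift (f : R -> Sol) :
  {morph f : s t / s + t} -> continuous f ->
  exists v, forall t, f t = sol_pi M (t *: v).
Proof.
move=> fD fc.
have /choice[a aP] : forall ji : nat * 'I_n, exists a,
    forall t, sol_coord ji.1 ji.2 (f t) = circle_proj (a * t).
  move=> [j i]; apply: circle_hom_lift => [s t|]; first by rewrite fD sol_coordD.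
  exact: continuous_sol_coord_comp.
pose v j := \col_i a (j, i).
have fv j t : val (f t) j = torus_proj (t *: v j).
  apply/colP => i; have := aP (j, i) t; rewrite /sol_coord /= => ->.
  by rewrite !mxE mulrC.
have vS j : v j = map_mx intr (M j) *m v j.+1.
  apply/colP => i; apply: circle_proj_lin_inj => t.
  have /set_mem/(_ j) := valP (f t).
  rewrite !fv torus_mul_proj -scalemxAr => /colP/(_ i).
  by rewrite !mxE ![t * _]mulrC.
have vE j : v j = inv_prod R M j *m v 0%N.
  elim: j => [|j IH]; first by rewrite mul1mx.
  rewrite /= -mulmxA -IH (vS j) mulKmx // unitmxE unitfE det_map_mx intr_eq0.
  exact: mxsP.
exists (v 0%N) => t; apply: val_inj; apply: funext => j.
by rewrite fv vE /= /pi_seq scalemxAr.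
Qed.

Lemma sol_pi_mx_inj m (A B : 'M[R]_(n, m)) :
  (forall t, sol_pi M (A *m t) = sol_pi M (B *m t)) -> A = B.
Proof.
move=> AB; apply/matrixP => i k; apply: circle_proj_lin_inj => s.
have := congr1 (sol_coord 0 i) (AB (s *: delta_mx k 0)).
rewrite !sol_coord_pi /= !mul1mx -!scalemxAr -!colE !mxE.
by rewrite ![s * _]mulrC.
Qed.
End OneParameter.

Definition continuous_hom (R : realType) m n (M : mxseq n) (M' : mxseq m)
    (g : solenoid R M -> solenoid R M') : Prop :=
  {morph g : x y / x + y} /\ continuous g.

Lemma continuous_hom0 (R : realType) m n (M : mxseq n) (M' : mxseq m)
    (g : solenoid R M -> solenoid R M') : {morph g : x y / x + y} -> g 0 = 0.
Proof. by move=> gD; apply: (@addrI _ (g 0)); rewrite -gD !addr0. Qed.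

(** The columns of the matrix are the images of the coordinate axes, which are
    one-parameter subgroups. *)
Lemma continuous_hom_mx (R : realType) m n (M : mxseq n) (M' : mxseq m)
    (g : solenoid R M -> solenoid R M') : continuous_hom g ->
  exists A : 'M[R]_(m, n), forall t, g (sol_pi M t) = sol_pi M' (A *m t).
Proof.
move=> [gD gc].
have /choice[v vP] : forall k : 'I_n, exists v, forall s : R,
    g (sol_pi M (s *: delta_mx k 0)) = sol_pi M' (s *: v).
  move=> k; apply: solenoid_hom_lift => [s t|t].
    by rewrite scalerDl sol_piD gD.
  apply: (@continuous_comp _ _ _ (fun s : R => sol_pi M (s *: delta_mx k 0)) g).
    exact: continuous_sol_pi_line.
  exact: gc.
exists (\matrix_(i, k) v k i 0) => t.
have tE : t = \sum_k t k 0 *: delta_mx k 0.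
  apply/colP => i; rewrite summxE (bigD1 i) //= !mxE !eqxx mulr1 big1 ?addr0 //.
  by move=> k /negPf ki; rewrite !mxE eq_sym ki mulr0.
have AE : (\matrix_(i, k) v k i 0) *m t = \sum_k t k 0 *: v k.
  apply/colP => i; rewrite summxE mxE; apply: eq_bigr => k _.
  by rewrite !mxE mulrC.
rewrite AE {1}tE.
apply: (big_ind2 (fun x y => g (sol_pi M x) = sol_pi M' y)) => [|x x' y y' h1 h2|k _].
- by rewrite !sol_pi0 (continuous_hom0 gD).
- by rewrite !sol_piD gD h1 h2.
exact: vP.
Qed.

(** * Density of irrational orbits *)

Section Kronecker.
Variable R : realType.
Implicit Types (x y z e : R) (k l : int).

Definition incommensurable x y :=
  forall k l, k%:~R * x + l%:~R * y = 0 -> k = 0 /\ l = 0.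

(** One step of the Euclidean algorithm, with nearest-integer quotient. *)
Lemma euclid_step x y : incommensurable x y ->
  exists k, incommensurable y (x - k%:~R * y) /\
    `|x - k%:~R * y| <= `|y| / 2.
Proof.
move=> xy; have y0 : y != 0.
  by apply/eqP => y0; have [|_ //] := xy 0 1; rewrite y0 mulr0 mul0r addr0.
exists (Num.floor (x / y + 2^-1)); set k := Num.floor _; split.
  move=> a b ab; have [|b0 abk] := xy b (a - b * k).
    by rewrite -[RHS]ab intrD mulrNz intrM; ring.
  by split=> //; move: abk; rewrite b0 mul0r subr0.
have /andP[] : k%:~R <= x / y + 2^-1 < (k + 1)%:~R by exact: floor_itv.
rewrite intrD => h1 h2.
have -> : x - k%:~R * y = (x / y - k%:~R) * y by rewrite mulrBl divfK.
rewrite normrM mulrC ler_wpM2l // ler_norml; move: h1 h2; lra.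
Qed.

(** The Euclidean algorithm does not stop on incommensurable numbers, so their
    integer combinations take arbitrarily small non-zero values. *)
Lemma euclid_small n x y : incommensurable x y ->
  exists k l, 0 < `|k%:~R * x + l%:~R * y| <= `|y| / 2 ^+ n.
Proof.
elim: n x y => [|n IH] x y xy.
  exists 0, 1; rewrite mul0r add0r mul1r expr0 divr1 lexx andbT normr_gt0.
  by apply/eqP => y0; have [|_ //] := xy 0 1; rewrite y0 mulr0 mul0r addr0.
have [k [/IH[a [b ab]] xk]] := euclid_step xy.
exists b, (a - b * k).
have -> : b%:~R * x + (a - b * k)%:~R * y =
    a%:~R * y + b%:~R * (x - k%:~R * y).
  by rewrite intrD mulrNz intrM; ring.
move: ab => /andP[-> ab] /=; apply: le_trans ab _.
by rewrite exprS invfM mulrA ler_wpM2r // invr_ge0 exprn_ge0.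
Qed.

(** Kronecker's theorem in dimension 1. *)
Lemma irrational_dense x y z e : incommensurable x y -> 0 < e ->
  exists k l, `|k%:~R * x + l%:~R * y - z| < e.
Proof.
move=> xy e0; have [n yn] := exp2_large (`|y| / e).
have [k [l /andP[]]] := euclid_small n xy.
set g := _ + _; rewrite normr_gt0 => g0 gy.
have ge : `|g| < e.
  apply: le_lt_trans gy _; rewrite ltr_pdivrMr ?exprn_gt0 // mulrC.
  by rewrite -ltr_pdivrMr.
pose m := Num.floor (z / g); exists (m * k), (m * l).
apply: le_lt_trans ge.
have -> : (m * k)%:~R * x + (m * l)%:~R * y - z = (m%:~R - z / g) * g.
  rewrite mulrBl divfK // !intrM /g; ring.
have /andP[] : m%:~R <= z / g < (m + 1)%:~R by exact: floor_itv.
rewrite intrD => h1 h2.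
rewrite normrM ler_piMl // ler_norml; move: h1 h2; lra.
Qed.
End Kronecker.

Section Diagonal.
Variables (R : realType) (n : nat) (M : mxseq n) (S : 'I_n -> nzseq).

(** Covers both the solenoids of integer sequences and those of diag(p, q). *)
Definition diagonal_mxseq := forall j i k, M j i k = S i j *+ (i == k).
Hypothesis MS : diagonal_mxseq.
Local Notation Sol := (solenoid R M).

Lemma diag_sum (V : zmodType) (x : 'cV[V]_n) j i :
  \sum_k x k 0 *~ M j i k = x i 0 *~ S i j.
Proof.
rewrite (bigD1 i) //= MS eqxx big1 ?addr0 // => k /negPf ki.
by rewrite MS eq_sym ki mulr0n mulr0z.
Qed.

Lemma sol_coord_diag j i (x : Sol) :
  sol_coord j i x = sol_coord j.+1 i x *~ S i j.
Proof.
have /set_mem/(_ j) := valP x.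
by rewrite /sol_coord => /colP/(_ i) ->; rewrite mxE diag_sum.
Qed.

Lemma diag_sol_ex (c : nat -> 'I_n -> circle R) :
  (forall j i, c j i = c j.+1 i *~ S i j) ->
  exists x : Sol, forall j i, sol_coord j i x = c j i.
Proof.
move=> cS; have sP : solenoid_pred M (fun j => \col_i c j i : torus R n).
  by apply: mem_set => j; apply/colP => i; rewrite !mxE diag_sum mxE.
by exists (Sub _ sP) => j i; rewrite /sol_coord /= mxE.
Qed.

Lemma inv_prod_diag (t : 'cV[R]_n) j i :
  (inv_prod R M j *m t) i 0 = t i 0 / (\prod_(l < j) S i l)%:~R.
Proof.
elim: j => [|j IH]; first by rewrite big_ord0 divr1 mul1mx.
have u : map_mx intr (M j) \in @unitmx R n.
  by rewrite unitmxE unitfE det_map_mx intr_eq0 mxsP.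
have s0 : (S i j)%:~R != 0 :> R by rewrite intr_eq0 nzsP.
rewrite big_ord_recr /= intrM invfM mulrA -IH.
have -> : inv_prod R M j *m t = map_mx intr (M j) *m (inv_prod R M j.+1 *m t).
  by rewrite /= -mulmxA mulKVmx.
set y := inv_prod R M j.+1 *m t.
have -> : (map_mx intr (M j) *m y) i 0 = y i 0 *~ S i j.
  rewrite -(diag_sum y) mxE; apply: eq_bigr => k _.
  by rewrite mxE mulrzl.
by rewrite -mulrzl mulrAC divff ?mul1r.
Qed.

Lemma sol_coord_diag_pi (t : 'cV[R]_n) j i :
  sol_coord j i (sol_pi M t) = circle_proj (t i 0 / (\prod_(l < j) S i l)%:~R).
Proof. by rewrite sol_coord_pi inv_prod_diag. Qed.

Lemma prod_nz (P : nzseq) j : (\prod_(l < j) P l)%:~R != 0 :> R.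
Proof. by rewrite intr_eq0; apply/prodf_neq0 => l _; exact: nzsP. Qed.

Lemma prod_dvd (P : nzseq) j N : (j <= N)%N ->
  exists k : int, (\prod_(l < N) P l = k * \prod_(l < j) P l)%R.
Proof.
move=> /subnK <-; elim: (N - j)%N => [|d [k IH]].
  by exists 1; rewrite mul1r.
by exists (k * P (d + j)%N); rewrite addSn big_ord_recr /= IH mulrAC.
Qed.

(** Up to level [N], a point is determined by its [N]-th level, which lifts to
    the Euclidean space; so the image of [sol_pi] is dense. *)
Lemma sol_pi_approx N (x : Sol) : exists v : 'cV[R]_n,
  forall j i, (j <= N)%N -> sol_coord j i x = sol_coord j i (sol_pi M v).
Proof.
have /choice[u uP] : forall i, exists u, circle_proj u = sol_coord N i x.
  by move=> i; exact: circle_proj_surj.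
exists (\col_i (u i * (\prod_(l < N) S i l)%:~R)) => j i jN.
move: (subnKC jN); move: (N - j)%N => d {jN}.
elim: d j => [|d IH] j.
  by rewrite addn0 => ->; rewrite sol_coord_diag_pi mxE mulfK ?uP // prod_nz.
by rewrite -addSnnS => /IH e; rewrite !(sol_coord_diag j) e.
Qed.
End Diagonal.

Definition pair_seq (P Q : nzseq) (i : 'I_2) : nzseq := tnth [tuple P; Q] i.

Lemma ord2 (i : 'I_2) : i = 0 \/ i = 1.
Proof. by case: i => [[|[|//]] lt]; [left|right]; apply: val_inj. Qed.

Lemma diag_mxseqP P Q : diagonal_mxseq (diag_mxseq P Q) (pair_seq P Q).
Proof.
have e0 : 0 = @lshift 1 1 0 :> 'I_2 by apply: val_inj.
have e1 : 1 = @rshift 1 1 0 :> 'I_2 by apply: val_inj.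
move=> j i k; rewrite /= /diag2.
have [->|->] := ord2 i; have [->|->] := ord2 k; rewrite ?e0 ?e1.
- by rewrite (@block_mxEul _ 1 1 1 1) mxE.
- by rewrite (@block_mxEur _ 1 1 1 1) mxE.
- by rewrite (@block_mxEdl _ 1 1 1 1) mxE.
- by rewrite (@block_mxEdr _ 1 1 1 1) mxE.
Qed.

Lemma lower2E (R : realType) (A : 'M[R]_2) : A 0 1 = 0 ->
  A = lower2 (A 0 0) (A 1 0) (A 1 1).
Proof.
have e0 : 0 = @lshift 1 1 0 :> 'I_2 by apply: val_inj.
have e1 : 1 = @rshift 1 1 0 :> 'I_2 by apply: val_inj.
move=> A01; apply/matrixP => i k; rewrite /lower2.
have [->|->] := ord2 i; have [->|->] := ord2 k; rewrite -?A01 ?e0 ?e1.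
- by rewrite (@block_mxEul _ 1 1 1 1) mxE.
- by rewrite (@block_mxEur _ 1 1 1 1) mxE -A01 e0 e1.
- by rewrite (@block_mxEdl _ 1 1 1 1) mxE.
- by rewrite (@block_mxEdr _ 1 1 1 1) mxE.
Qed.

Lemma scalar_mxseqP P : diagonal_mxseq (scalar_mxseq P) (fun _ => P).
Proof. by move=> j i k; rewrite mxE. Qed.

Lemma solenoid_fun_dense_eq (R : realType) m (M : mxseq m) (X : topologicalType)
    (f g : X -> solenoid R M) (D : set X) :
  dense D -> continuous f -> continuous g -> (forall x, D x -> f x = g x) ->
  f = g.
Proof.
move=> Dd fc gc fg; apply: funext => x; apply: sol_coord_inj => j i.
apply: subr0_eq.
pose d y := sol_coord j i (f y) - sol_coord j i (g y).
apply: (@circle_fun_dense0 _ _ d D) => //.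
  move=> y; apply: cvg_circleD; last apply: cvg_circleN.
    exact: continuous_sol_coord_comp.
  exact: continuous_sol_coord_comp.
by rewrite /d => y /fg ->; rewrite subrr.
Qed.

Section Plane.
Variables (R : realType) (P Q : nzseq).
Local Notation M := (diag_mxseq P Q).
Local Notation Sol := (solenoid R M).

(** A neighbourhood of [x] sees finitely many levels, where [x] looks like
    [sol_pi v]. So the orbit has to approach [v] modulo [L 0] in the first
    coordinate and modulo [L 1] in the second. The time [t] below makes the
    first coordinate exact for any integer [k]; Kronecker's theorem then
    chooses [k] for the second. *)
Lemma irrational_orbit_dense (w : 'cV[R]_2) : irrational_direction w ->
  dense (range (fun t : R => sol_pi M (t *: w)) : set Sol).
Proof.
move=> w_irr O [x Ox] oO.
have [N [e [e0 HO]]] : exists (N : nat) (e : R), 0 < e /\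
    forall y : Sol, (forall j i, (j <= N)%N ->
      circle_arc e (sol_coord j i y - sol_coord j i x)) -> O y.
  by apply: nbhs_solenoid; exact: open_nbhs_nbhs.
have [v xv] := sol_pi_approx (@diag_mxseqP P Q) N x.
pose L i : R := (\prod_(l < N) pair_seq P Q i l)%:~R.
have L0 i : L i != 0 by exact: prod_nz.
have w0 : w 0 0 != 0.
  apply/eqP => w0; have [|//] := w_irr 1 0.
  by rewrite w0 mulr0 mul0r addr0.
have [k [l kl]] : exists k l : int, `|k%:~R * (L 0 * w 1 0 / w 0 0) + l%:~R * L 1 -
    (v 1 0 - v 0 0 / w 0 0 * w 1 0)| < e.
  apply: irrational_dense => // k l kl.
  have [] := w_irr (l * \prod_(l < N) Q l) (k * \prod_(l < N) P l).
    have : w 0 0 * (k%:~R * (L 0 * w 1 0 / w 0 0) + l%:~R * L 1) = 0.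
      by rewrite kl mulr0.
    rewrite /L /pair_seq !(tnth_nth P) /= !intrM => <-; by field.
  move=> /eqP + /eqP; rewrite !mulf_eq0.
  have nz (S : nzseq) : \prod_(l < N) S l != 0.
    by apply/prodf_neq0 => *; exact: nzsP.
  rewrite (negPf (nz P)) (negPf (nz Q)).
  by rewrite !orbF => /eqP + /eqP.
pose t := (v 0 0 + k%:~R * L 0) / w 0 0.
exists (sol_pi M (t *: w)); split; last by exists t.
apply: HO => j i jN; rewrite xv // !(sol_coord_diag_pi (@diag_mxseqP P Q)).
pose z i : int := if i == 0 :> 'I_2 then k else - l.
have tz : `|t * w i 0 - v i 0 - (z i)%:~R * L i| < e.
  rewrite /z; have [->|->] /= := ord2 i.
    by rewrite (_ : _ - _ - _ = 0) ?normr0 // /t; field.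
  rewrite mulrNz mulNr opprK; congr (`|_| < e) : kl.
  by rewrite /t; field.
have [b Lb] := prod_dvd (pair_seq P Q i) jN.
have bj : (\prod_(l < j) pair_seq P Q i l)%:~R != 0 :> R by exact: prod_nz.
rewrite -raddfB /= !mxE.
set Lj : R := (\prod_(l < j) pair_seq P Q i l)%:~R in bj *.
exists ((t * w i 0 - v i 0 - (z i)%:~R * L i) / Lj).
  rewrite /= normrM; apply: le_lt_trans tz.
  rewrite ler_piMr // normfV invf_le1 ?normr_gt0 //.
  apply: norm_intr_ge1 => //; exact: intr_int.
have -> : (t * w i 0 - v i 0 - (z i)%:~R * L i) / Lj =
   t * w i 0 / Lj - v i 0 / Lj - (z i * b)%:~R.
  by rewrite /L Lb !intrM /Lj; field.
by rewrite raddfB /= circle_proj_int subr0.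
Qed.

(** For fixed [y] both sides are continuous in [x], and for [x] on the orbit of
    0 they agree because [h] carries the translations of one flow to those of
    the other. *)
Lemma equivalence_hom (w w' : 'cV[R]_2) (alpha : R -> R) (h : Sol -> Sol) :
  irrational_direction w -> continuous h ->
  (forall t x, h (linear_flow M w t x) = linear_flow M w' (alpha t) (h x)) ->
  {morph (fun x => h x - h 0) : x y / x + y}.
Proof.
move=> w_irr hc hE x y.
have hw t z : h (sol_pi M (t *: w) + z) = sol_pi M (alpha t *: w') + h z.
  exact: hE.
suff /(congr1 (@^~ x)) /= -> : (fun x => h (x + y) - h 0) =
  (fun x => (h x - h 0) + (h y - h 0)) by [].
have cc (c : Sol) : continuous (fun _ : Sol => c) by exact: cst_continuous.
apply: (solenoid_fun_dense_eq (irrational_orbit_dense w_irr)).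
- apply: continuous_solenoid_add => [u|]; last exact: cc.
  apply: (@continuous_comp _ _ _ (fun x => x + y) h); last exact: hc.
  by apply: continuous_solenoid_add => [v|]; [exact: cvg_id | exact: cc].
- apply: continuous_solenoid_add; last exact: cc.
  by apply: continuous_solenoid_add.
move=> _ [t _ <-]; rewrite hw -[in X in _ = X](addr0 (sol_pi M _)) hw.
by rewrite addrK addrA.
Qed.

(** An entry of the matrix of an endomorphism is the composite with the
    inclusion [f] of one factor and the projection [p] onto another. *)
Lemma entry_hom (h : Sol -> Sol) (A : 'M[R]_2) : continuous_hom h ->
  (forall t, h (sol_pi M t) = sol_pi M (A *m t)) ->
  forall i k, exists2 g : solenoid R (scalar_mxseq (pair_seq P Q k)) ->
                         solenoid R (scalar_mxseq (pair_seq P Q i)),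
    continuous_hom g & forall s, g (sol1_pi _ s) = sol1_pi _ (A i k * s).
Proof.
move=> [hD hc] hA i k.
have /choice[f fP] : forall y : solenoid R (scalar_mxseq (pair_seq P Q k)),
    exists x : Sol, forall j l,
      sol_coord j l x = sol_coord j 0 y *+ (l == k).
  move=> y; apply: (diag_sol_ex (@diag_mxseqP P Q)) => j l.
  case: eqP => [->|_]; last by rewrite mul0rz.
  by rewrite !mulr1n (sol_coord_diag (@scalar_mxseqP _)).
have /choice[p pP] : forall x : Sol,
    exists y : solenoid R (scalar_mxseq (pair_seq P Q i)),
      forall j l, sol_coord j l y = sol_coord j i x.
  move=> y; apply: (diag_sol_ex (@scalar_mxseqP _)) => j l.
  by rewrite (sol_coord_diag (@diag_mxseqP P Q)).
exists (p \o h \o f); first split.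
- have fD : {morph f : x y / x + y}.
    move=> x y; apply: sol_coord_inj => j l.
    by rewrite sol_coordD !fP sol_coordD mulrnDl.
  move=> x y /=; rewrite fD hD; apply: sol_coord_inj => j l.
  by rewrite sol_coordD !pP sol_coordD.
- have fc : continuous f.
    apply: continuous_solenoid => j l; under eq_fun do rewrite fP.
    by case: (l == k); [exact: continuous_sol_coord | exact: cst_continuous].
  have pc : continuous p.
    apply: continuous_solenoid => j l; under eq_fun do rewrite pP.
    exact: continuous_sol_coord.
  move=> x; apply: continuous_comp; first exact: fc.
  by apply: continuous_comp; [exact: hc|exact: pc].
move=> s /=; have -> : f (sol1_pi _ s) = sol_pi M (s *: delta_mx k 0).
  apply: sol_coord_inj => j l; rewrite fP (sol_coord_diag_pi (@diag_mxseqP P Q)).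
  rewrite (sol_coord_diag_pi (@scalar_mxseqP _)) !mxE.
  have [->|_] := eqVneq l k; first by rewrite mulr1.
  by rewrite mulr0n mulr0 mul0r raddf0.
rewrite hA; apply: sol_coord_inj => j l.
rewrite pP (sol_coord_diag_pi (@diag_mxseqP P Q)).
rewrite (sol_coord_diag_pi (@scalar_mxseqP _)).
by rewrite -scalemxAr -colE !mxE [s * _]mulrC.
Qed.
End Plane.

(** * Comparison of sequences *)

(** What a proper arrangement provides; the equation says that the terms are
    positive. *)
Definition prime_terms (P : nzseq) :=
  forall j, P j = `|P j|%N%:Z /\ ((`|P j|%N == 1%N) || prime `|P j|%N).

(** The enumeration runs through each antidiagonal with [i] increasing and then
    starts the next one at [i = 1]. *)
Lemma f0_surj j : exists k i, [/\ (0 < k)%N, (0 < i)%N & (f0 k i).-1 = j].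
Proof.
elim: j => [|j [k [i [k0 i0 <-]]]]; first by exists 1%N, 1%N.
have f0_gt k' i' : (0 < i')%N -> (0 < f0 k' i')%N by rewrite /f0; lia.
case: k k0 => [//|[|k] _].
  exists i.+1, 1%N; split => //; rewrite prednK ?f0_gt //.
  rewrite /f0; have -> : ((1 + i - 2) * (1 + i - 1) = i.-1 * i)%N by lia.
  have -> : ((i.+1 + 1 - 2) * (i.+1 + 1 - 1) = i.-1 * i + i.*2)%N by nia.
  by rewrite halfD odd_double andbF doubleK add0n addn1.
exists k.+1, i.+1; split => //; rewrite prednK ?f0_gt //.
by rewrite /f0 !addnS !addSn.
Qed.

Lemma nth_prime_prime k : (0 < k)%N -> prime (nth_prime k).
Proof.
case: k => [//|k] _; rewrite /nth_prime /= /next_prime.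
by case: ex_minnP => p /andP[].
Qed.

Lemma arranged_prime_terms P Q : properly_arranged_pair P Q ->
  forall i, prime_terms (pair_seq P Q i).
Proof.
move=> PQ i j; have [k [l [k0 l0 <-]]] := f0_surj j.
rewrite /pair_seq (PQ i k l k0 l0) /arranged_term.
by case: ifP => _ //=; rewrite nth_prime_prime // orbT.
Qed.

Section Counting.
Implicit Types (P Q : nzseq) (q j k N u : nat).

Definition occurrences P q j : nat := \sum_(l < j) (`|P l|%N == q).

Lemma occurrencesS P q j :
  occurrences P q j.+1 = (occurrences P q j + (`|P j|%N == q))%N.
Proof. by rewrite /occurrences big_ord_recr. Qed.

Lemma occurrences_mono P q j k :
  (j <= k)%N -> (occurrences P q j <= occurrences P q k)%N.
Proof.
move=> /subnKC <-; elim: (k - j)%N => [|d IH]; first by rewrite addn0.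
by rewrite addnS occurrencesS (leq_trans IH) // leq_addr.
Qed.

Lemma occurrences_inj P q j k : `|P j|%N = q -> `|P k|%N = q ->
  occurrences P q j = occurrences P q k -> j = k.
Proof.
have lt a b : `|P a|%N = q -> (a < b)%N -> (occurrences P q a < occurrences P q b)%N.
  move=> aq ab; apply: leq_trans (occurrences_mono P q ab).
  by rewrite occurrencesS aq eqxx addn1.
move=> jq kq; have [/lt|/lt|//] := ltngtP j k;
  by move=> /(_ _); rewrite ?jq ?kq; lia.
Qed.

Lemma occurrences_ivt Q q N m : (m < occurrences Q q N)%N ->
  exists k, `|Q k|%N = q /\ occurrences Q q k = m.
Proof.
elim: N => [|N IH]; first by rewrite /occurrences big_ord0.
rewrite occurrencesS; have [/IH //|Nm] := ltnP m (occurrences Q q N).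
case: eqP => [Nq|_] mN; last by move: mN; lia.
by exists N; split => //; move: mN; lia.
Qed.

Lemma logn_prod P q j : prime_terms P -> prime q ->
  logn q (\prod_(l < j) `|P l|)%N = occurrences P q j.
Proof.
move=> Pp q_pr; have P0 l : (0 < `|P l|)%N by rewrite absz_gt0 nzsP.
elim: j => [|j IH]; first by rewrite big_ord0 logn1 /occurrences big_ord0.
rewrite big_ord_recr lognM //; last by rewrite prodn_gt0.
rewrite IH occurrencesS; congr addn.
have [_ /orP[/eqP ->|pr]] := Pp j.
  by rewrite logn1; case: eqP q_pr => // <-.
by rewrite logn_prime // eq_sym.
Qed.

Lemma derived_prime_terms P k : prime_terms P -> derived P k = `|P k|%N.
Proof.
move=> Pp; have fE j : factors (P j) = [:: `|P j|%N].
  rewrite /factors; have [_] := Pp j; case: eqP => [-> //|_ /= pr].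
  by rewrite prime_decompE primes_prime //= logn_prime // eqxx cats0.
rewrite /derived (eq_map fE) flatten_map1 (nth_map 0%N) ?size_iota //.
by rewrite nth_iota.
Qed.

(** Delete from [P] the first [logn q u] occurrences of each prime [q], which
    are finitely many terms in all since only the divisors of [u] matter.
    By divisibility, [Q] contains [q] at least as often as the rest of [P]:
    sending the occurrence of [q] in [P] of rank [m] to the occurrence in [Q]
    of rank [m - logn q u] is injective, whether or not [q] occurs infinitely
    often. *)
Lemma le_seq_dvd P Q u : prime_terms P -> prime_terms Q -> (0 < u)%N ->
  (forall j, exists N, \prod_(l < j) `|P l| %| u * \prod_(l < N) `|Q l|)%N ->
  le_seq P Q.
Proof.
move=> Pp Qp u0 PQ.
have cnt q j : prime q -> exists N,
    (occurrences P q j <= logn q u + occurrences Q q N)%N.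
  move=> q_pr; have [N dv] := PQ j; exists N.
  have Q0 : (0 < \prod_(l < N) `|Q l|)%N.
    by rewrite prodn_gt0 // => l; rewrite absz_gt0 nzsP.
  rewrite -!logn_prod // -lognM //; apply: dvdn_leq_log => //.
  by rewrite muln_gt0 u0.
exists [set k | prime `|P k|%N /\
               (occurrences P `|P k| k < logn `|P k| u)%N]; split.
  pose f k := (`|P k|%N, occurrences P `|P k| k).
  apply: (@sub_finite_set _ _ (f @^-1` (`I_u.+1 `*` `I_u.+1))).
    move=> k /= [pr lt].
    have l0 : (0 < logn `|P k| u)%N by exact: leq_ltn_trans lt.
    have pu : (`|P k| ^ logn `|P k| u <= u)%N.
      by apply: dvdn_leq => //; exact: pfactor_dvdnn.
    have := ltn_expl (logn `|P k| u) (prime_gt1 pr).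
    rewrite /f /= !ltnS; split; last by lia.
    apply: leq_trans pu.
    by rewrite -[X in (X <= _)%N]expn1 leq_exp2l // prime_gt1.
  apply: finite_preimage; last by apply: finite_setX; exact: finite_II.
  by move=> k k' _ _ [e1]; rewrite -e1; apply: occurrences_inj.
move=> q q_pr; set A := _ `\` _.
have /choice[f fP] : forall k, exists k', A k ->
    `|Q k'|%N = q /\ (logn q u + occurrences Q q k')%N = occurrences P q k.
  move=> k; have [kA|] := pselect (A k); last by exists 0%N.
  case: kA; rewrite /occ /= derived_prime_terms // => kq nD.
  have uk : (logn q u <= occurrences P q k)%N.
    by rewrite leqNgt; apply/negP => lt; apply: nD; rewrite kq.
  have [N] := cnt q k.+1 q_pr; rewrite occurrencesS kq eqxx => le.
  have [|k' [k'q k'E]] :=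
    @occurrences_ivt Q q N (occurrences P q k - logn q u)%N; first by lia.
  by exists k' => _; split => //; rewrite k'E subnKC.
have f_inj : {in A &, injective f}.
  move=> k k' /set_mem kA /set_mem k'A ff.
  have [[_ e] [_ e']] := (fP _ kA, fP _ k'A); rewrite ff e' in e.
  case: kA k'A => [+ _] [+ _]; rewrite /occ /= !derived_prime_terms // => kq k'q.
  exact: (@occurrences_inj P q).
rewrite -(card_le_eql (inj_card_eq f_inj)).
apply: subset_card_le => _ [k /fP[fq _] <-].
by rewrite /occ /= derived_prime_terms.
Qed.
End Counting.

(** * Multipliers *)

Section Multipliers.
Variable R : realType.
Implicit Types (P Q : nzseq) (r : R).

Lemma sol1_coord P j l (s : R) :
  sol_coord j l (sol1_pi P s) = circle_proj (s / (\prod_(i < j) P i)%:~R).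
Proof. by rewrite (sol_coord_diag_pi (@scalar_mxseqP P)) mxE. Qed.

Lemma sol1_piD P (s t : R) : sol1_pi P (s + t) = sol1_pi P s + sol1_pi P t.
Proof.
apply: sol_coord_inj => j l.
by rewrite sol_coordD !sol1_coord mulrDl raddfD.
Qed.

(** The points [sol1_pi Q (m * \prod_(i < N) Q i)], [m] an integer, vanish up
    to level [N]. For [N] large, coordinate [j] of [g] maps this subgroup into a
    small arc, hence to 0: the circle has no small subgroups. *)
Lemma hom_integral P Q r
    (g : solenoid R (scalar_mxseq Q) -> solenoid R (scalar_mxseq P)) :
  continuous_hom g -> (forall s, g (sol1_pi Q s) = sol1_pi P (r * s)) ->
  forall j, exists N,
    r * (\prod_(i < N) Q i)%:~R / (\prod_(i < j) P i)%:~R \is a Num.int.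
Proof.
move=> [gD gc] gE j.
have g0 : g 0 = 0 by exact: continuous_hom0.
pose U := [set x : solenoid R (scalar_mxseq Q) |
  circle_arc (R := R) 4^-1 (sol_coord j 0 (g x))].
have nU : nbhs 0 U.
  have cg := @continuous_sol_coord_comp R 1 (scalar_mxseq P) _ g j 0 gc 0.
  have h : nbhs (sol_coord j 0 (g 0)) (circle_arc (R := R) 4^-1).
    apply/nbhs_circleP; exists (4^-1); first by rewrite invr_gt0 ltr0n.
    by move=> d; rewrite g0 sol_coord0 add0r.
  exact: (cg _ h).
have [N [e [e0 HU]]] := nbhs_solenoid nU.
exists N; apply/circle_proj_eq0/circle_no_small_subgroup => m.
have : U (sol1_pi Q (m%:R * (\prod_(i < N) Q i)%:~R)).
  apply: HU => k l kN; rewrite sol_coord0 subr0 sol1_coord.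
  have [b ->] := prod_dvd Q kN; rewrite intrM mulrA mulfK ?prod_nz //.
  rewrite -[m%:R]/((m%:Z)%:~R) -intrM circle_proj_int.
  by exists 0; rewrite ?raddf0 //= normr0.
rewrite /U /= gE sol1_coord; congr (circle_arc _ _).
by rewrite -raddfMn /= -mulr_natl; congr circle_proj; ring.
Qed.

(** Level 0 of [hom_integral] shows that [r] is rational; clearing its
    denominator in the other levels bounds the products of [P] by those of
    [Q] up to the fixed factor [u]. *)
Lemma hom_le_seq P Q r
    (g : solenoid R (scalar_mxseq Q) -> solenoid R (scalar_mxseq P)) :
  prime_terms P -> prime_terms Q -> r != 0 ->
  continuous_hom g -> (forall s, g (sol1_pi Q s) = sol1_pi P (r * s)) ->
  le_seq P Q.
Proof.
move=> Pp Qp r0 gh gE; have rPQ := hom_integral gh gE.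
have absz_prod := big_morph absz abszM (erefl : `|1%R|%N = 1%N).
have [N0] := rPQ 0%N; rewrite big_ord0 divr1 => /intrP[u uE].
have u0 : u != 0 by rewrite -(intr_eq0 R) -uE mulf_neq0 ?prod_nz.
apply: (@le_seq_dvd P Q `|u|%N) => //; first by rewrite absz_gt0.
move=> j; have [N /intrP[z zE]] := rPQ j; exists N.
have : (u * \prod_(i < N) Q i = z * \prod_(i < N0) Q i * \prod_(i < j) P i).
  apply/eqP; rewrite -(eqr_int R) !intrM -uE -zE; apply/eqP.
  by field; exact: prod_nz.
move=> /(congr1 absz); rewrite !abszM !absz_prod => ->.
exact: dvdn_mull.
Qed.

Lemma prod_stable P N N' : (forall j, (N <= j)%N -> P j = 1) -> (N <= N')%N ->
  \prod_(i < N') P i = \prod_(i < N) P i.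
Proof.
move=> P1 /subnKC <-; elim: (N' - N)%N => [|d IH]; first by rewrite addn0.
by rewrite addnS big_ord_recr /= IH P1 ?leq_addr // mulr1.
Qed.

(** If [P] is eventually 1, subtract a multiple of the product of its terms. *)
Lemma param_dom_ex P (s : R) : (forall j, 0 < P j) ->
  exists s', param_dom P s' /\ sol1_pi P s' = sol1_pi P s.
Proof.
move=> P0; have [[N PN]|nex] := pselect (exists N, forall j, (N <= j)%N -> P j = 1);
  last first.
  by exists s; split => // N PN; exfalso; apply: nex; exists N.
pose p : R := (\prod_(i < N) P i)%:~R.
have p0 : 0 < p by rewrite ltr0z; apply: prodr_gt0 => i _; exact: P0.
pose k := Num.floor (s / p).
exists (s - k%:~R * p); split.
  move=> N' PN'; have -> : \prod_(i < N') P i = \prod_(i < N) P i.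
    have [le|/ltnW le] := leqP N N'; first exact: prod_stable.
    by rewrite (prod_stable PN' le).
  have /andP[] : k%:~R <= s / p < (k + 1)%:~R by exact: floor_itv.
  rewrite ler_pdivlMr // ltr_pdivrMr // intrD mulrDl mul1r => h1 h2.
  by rewrite -/p subr_ge0 h1 ltrBlDl.
apply: sol_coord_inj => j l; rewrite !sol1_coord mulrBl raddfB /=.
have [b bE] : exists b : int, p = b%:~R * (\prod_(i < j) P i)%:~R.
  have [jN|/ltnW Nj] := leqP j N.
    by have [b bE] := prod_dvd P jN; exists b; rewrite /p bE intrM.
  by exists 1; rewrite mul1r (prod_stable PN Nj).
by rewrite bE -mulrA mulfK ?prod_nz // -intrM circle_proj_int subr0.
Qed.

(** On the path component, the multiplier map of [r] is the restriction of [g],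
    whichever parameter it selects. *)
Lemma proper_multiplier_hom P Q r
    (g : solenoid R (scalar_mxseq P) -> solenoid R (scalar_mxseq Q)) :
  (forall j, 0 < P j) -> continuous_hom g ->
  (forall s, g (sol1_pi P s) = sol1_pi Q (r * s)) -> proper_multiplier P Q r.
Proof.
move=> P0 [gD gc] gE.
have rg x : C_ P x -> multiplier_map r P Q x = g x.
  move=> [s _ <-]; rewrite /multiplier_map.
  have /getPex /= [_ sE] := param_dom_ex s P0.
  by rewrite -gE sE.
split.
  apply: (subspace_eq_continuous (f := g)); last exact: continuous_subspaceT.
  by move=> x /set_mem /rg.
move=> x y Cx Cy; rewrite !rg ?gD //.
by case: Cx Cy => s _ <- [t _ <-]; exists (s + t) => //; rewrite sol1_piD.
Qed.
End Multipliers.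

(** * Equivalent irrational flows *)

Theorem corollary10 (R : realType) (P Q : nzseq)
    (PQ_arranged : properly_arranged_pair P Q) (PQ_gt : gt_seq P Q)
    (w w' : 'cV[R]_2) (w_neq0 : w != 0) (w'_neq0 : w' != 0)
    (w_irr : irrational_direction w) (w'_irr : irrational_direction w')
    (equiv_ww' : equivalent_flows (linear_flow (diag_mxseq P Q) w)
                                  (linear_flow (diag_mxseq P Q) w')) :
  exists a c d : R,
    [/\ proper_multiplier P Q c,
        proper_multiplier P Q (c / (a * d)),
        iso_multiplier P a,
        iso_multiplier Q d &
        exists A_PQ : solenoid R (diag_mxseq P Q) -> solenoid R (diag_mxseq P Q),
          [/\ automorphism A_PQ,
              represents (lower2 a c d) A_PQ &
              exists alpha : R -> R,
                flow_equivalence alpha A_PQ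
                  (linear_flow (diag_mxseq P Q) w)
                  (linear_flow (diag_mxseq P Q) w')]].
Proof.
have terms := arranged_prime_terms PQ_arranged.
have pos i j : 0 < pair_seq P Q i j.
  by have [-> _] := terms i j; rewrite ltz_nat absz_gt0 nzsP.
have S0 : pair_seq P Q 0 = P by rewrite /pair_seq (tnth_nth P).
have S1 : pair_seq P Q 1 = Q by rewrite /pair_seq (tnth_nth P).
have [alpha [h [alphaP [hc [g [gc hK gK]]] hE]]] := equiv_ww'.
pose M := diag_mxseq P Q; pose Sol := solenoid R M.
pose H (x : Sol) : Sol := h x - h 0.
pose G (y : Sol) : Sol := g (y + h 0).
have HK : cancel H G by move=> x; rewrite /G /H subrK hK.
have GK : cancel G H by move=> x; rewrite /G /H gK addrK.
have HD : {morph H : x y / x + y} := equivalence_hom w_irr hc hE.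
have GD : {morph G : x y / x + y}.
  by move=> x y; apply: (can_inj HK); rewrite HD !GK.
have cc (c : Sol) : continuous (fun _ : Sol => c) by exact: cst_continuous.
have Hc : continuous H by apply: continuous_solenoid_add; [exact: hc | exact: cc].
have Gc : continuous G.
  move=> y; apply: (@continuous_comp _ _ _ (fun y => y + h 0) g); last exact: gc.
  by apply: continuous_solenoid_add => [v|]; [exact: cvg_id | exact: cc].
have [A HA] := continuous_hom_mx (conj HD Hc).
have [B GB] := continuous_hom_mx (conj GD Gc).
have AB : A *m B = 1%:M.
  apply: (@sol_pi_mx_inj _ _ M) => t.
  by rewrite mul1mx -mulmxA -HA -GB GK.
have proper (F : Sol -> Sol) (C : 'M[R]_2) : continuous_hom F ->
    (forall t, F (sol_pi M t) = sol_pi M (C *m t)) ->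
    forall i k, proper_multiplier (pair_seq P Q k) (pair_seq P Q i) (C i k).
  move=> Fh FC i k; have [f fh fE] := entry_hom Fh FC i k.
  exact: proper_multiplier_hom fE.
have zero (F : Sol -> Sol) (C : 'M[R]_2) : continuous_hom F ->
    (forall t, F (sol_pi M t) = sol_pi M (C *m t)) -> C 0 1 = 0.
  move=> Fh FC; have [f fh fE] := entry_hom Fh FC 0 1.
  apply/eqP; apply: contraT => C0; case: PQ_gt => _ [].
  by have := hom_le_seq (terms 0) (terms 1) C0 fh fE; rewrite S0 S1.
have A01 : A 0 1 = 0 by apply: (zero H).
have B01 : B 0 1 = 0 by apply: (zero G).
have ABe i k : A i 0 * B 0 k + A i 1 * B 1 k = (i == k)%:R.
  have := congr1 (fun X : 'M[R]_2 => X i k) AB.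
  rewrite !mxE !big_ord_recl big_ord0 addr0.
  by have -> : lift ord0 ord0 = 1 :> 'I_2 by apply: val_inj.
have a_inv : A 0 0 * B 0 0 = 1 by have := ABe 0 0; rewrite A01 mul0r addr0.
have d_inv : A 1 1 * B 1 1 = 1 by have := ABe 1 1; rewrite B01 mulr0 add0r.
have cd : A 1 0 * B 0 0 + A 1 1 * B 1 0 = 0 by have := ABe 1 0.
have a0 : A 0 0 != 0.
  by apply: contra_eq_neq a_inv => ->; rewrite mul0r eq_sym oner_eq0.
have d0 : A 1 1 != 0.
  by apply: contra_eq_neq d_inv => ->; rewrite mul0r eq_sym oner_eq0.
have B00 : B 0 0 = 1 / A 0 0 by rewrite -a_inv mulrAC divff ?mul1r.
have B11 : B 1 1 = 1 / A 1 1 by rewrite -d_inv mulrAC divff ?mul1r.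
have B10 : - B 1 0 = A 1 0 / (A 0 0 * A 1 1).
  apply: (mulfI d0); rewrite mulrN -[LHS]addr0 -cd B00; field.
  by rewrite a0 d0.
have HP := proper H A (conj HD Hc) HA; have GP := proper G B (conj GD Gc) GB.
exists (A 0 0), (A 1 0), (A 1 1); split.
- by have := HP 1 0; rewrite S0 S1.
(* The multiplier [c / (a * d)] is an entry of the inverse, up to sign. *)
- rewrite -B10.
  have Gh : continuous_hom (fun x => - G x).
    split=> [x y|]; first by rewrite GD opprD.
    exact: continuous_solenoid_opp.
  have GN t : - G (sol_pi M t) = sol_pi M (- B *m t) by rewrite GB mulNmx sol_piN.
  by have := proper _ _ Gh GN 1 0; rewrite S0 S1 mxE.
- by split=> //; [have := HP 0 0|have := GP 0 0]; rewrite ?B00 S0.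
- by split=> //; [have := HP 1 1|have := GP 1 1]; rewrite ?B11 S1.
exists H; split.
- by split=> //; split=> //; exists G.
- by move=> t; rewrite -lower2E // HA.
exists alpha; split=> //; first by split=> //; exists G.
by move=> t x; rewrite /H hE /linear_flow addrA.
Qed.
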